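(* Let $A$ be a non-zero positive bounded operator on a complex Hilbert space $\mathscr{H}$ and let $B,C\in\mathbb{B}_A(\mathscr{H})$. Then for every non-zero scalar $\alpha\in\mathbb{C}$, $$w_{A,e}^2(B,C)\le\min\{w_A^2(B-C),w_A^2(B+C)\}+\frac{\max\{1,|1-\alpha|\}\,\|C^\sharp C+BB^\sharp\|_A+2w_A(BC)}{|\alpha|}.$$
   Context: $\mathbb{B}(\mathscr{H})$ is the algebra of bounded linear operators on $\mathscr{H}$. For $x,y\in\mathscr{H}$, $\langle x,y\rangle_A=\langle Ax,y\rangle$ and $\|x\|_A=\langle Ax,x\rangle^{1/2}$. $\mathbb{B}_A(\mathscr{H})$ is the set of $T\in\mathbb{B}(\mathscr{H})$ for which there is $S\in\mathbb{B}(\mathscr{H})$ with $AS=T^*A$. For $T\in\mathbb{B}_A(\mathscr{H})$, $T^\sharp$ is the unique solution $X\in\mathbb{B}(\mathscr{H})$ of $AX=T^*A$ whose range is contained in $\overline{\mathcal{R}(A)}$. The $A$-operator seminorm is $\|T\|_A=\sup\{\|Tx\|_A:\|x\|_A=1\}$ (finite for $T\in\mathbb{B}_A(\mathscr{H})$), and the $A$-numerical radius is $w_A(T)=\sup\{|\langle Tx,x\rangle_A|:\|x\|_A=1\}$. The $A$-Euclidean operator radius of a pair is $w_{A,e}(B,C)=\sup\{(|\langle Bx,x\rangle_A|^2+|\langle Cx,x\rangle_A|^2)^{1/2}: \|x\|_A=1\}$. Superscript $2$ on $w_A$ and $w_{A,e}$ denotes the square of the value. *)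

(* Defs.v *)
From HB Require Import structures.
From mathcomp Require Import all_boot all_order all_algebra.
From mathcomp Require Import sesquilinear complex.
From mathcomp Require Import all_classical all_reals all_analysis.

Set Implicit Arguments.
Unset Strict Implicit.
Unset Printing Implicit Defensive.

Import Order.TTheory GRing.Theory Num.Theory.
Import numFieldNormedType.Exports.

Local Open Scope classical_set_scope.
Local Open Scope ring_scope.

(* A complex Hilbert space: a Banach space over [R[i]] whose norm comes from
   an inner product, linear in its first argument. *)
HB.mixin Record NormedModule_isHilbert (R : realType) H
    & CompleteNormedModule R[i] H := {
  inner : {dot H for Num.conj} ;
  inner_norm : forall x : H, inner x x = `|x| ^+ 2
}.

#[short(type="hilbertType")]
HB.structure Definition Hilbert (R : realType) :=
  {H of CompleteNormedModule R[i] H & NormedModule_isHilbert R H}.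

Section Operators.
Variables (R : realType) (H : hilbertType R).
Implicit Types (A S T X : H -> H) (x y : H).

Local Notation "''[' x , y ]" := (inner x y) : ring_scope.

Definition modulus (z : R[i]) : R := ComplexField.Normc.normc z.

Definition bounded_operator : set (H -> H) :=
  [set T | linear T /\ exists M : R[i], forall x, `|T x| <= M * `|x|].

(* In [R[i]], [0 <= z] says that [z] is real and nonnegative. *)
Definition positive_operator : set (H -> H) :=
  [set A | bounded_operator A /\ forall x, 0 <= '[A x, x]].

(* The adjoint exists and is unique when [T] is bounded (Riesz). *)
Definition adjoint T : H -> H :=
  xget 0 [set S | bounded_operator S /\ forall x y, '[T x, y] = '[x, S y]].

Definition innerA A x y : R[i] := '[A x, y].

(* For positive [A], [innerA A x x] is a nonnegative real. *)
Definition normA A x : R := Num.sqrt (complex.Re (innerA A x x)).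

Definition A_adjoint A T : set (H -> H) :=
  [set S | bounded_operator S /\ A \o S = adjoint T \o A].

Definition bounded_operatorA A : set (H -> H) :=
  [set T | bounded_operator T /\ exists S, A_adjoint A T S].

(* The solution exists for [T] in [bounded_operatorA A] (project any A-adjoint
   of [T] onto the closure of the range of [A]), and is unique because [A] is
   injective on that closure. *)
Definition sharp A T : H -> H :=
  xget 0 [set X | A_adjoint A T X /\ range X `<=` closure (range A)].

Definition sphereA A : set H := [set x | normA A x = 1].

(* The real [sup] below is the genuine supremum when the set is nonempty and
   bounded above, i.e. for [A] nonzero positive and operators in
   [bounded_operatorA A]. *)
Definition opnormA A T : R := sup [set normA A (T x) | x in sphereA A].

Definition numradiusA A T : R :=
  sup [set modulus (innerA A (T x) x) | x in sphereA A].

Definition euclradiusA A B C : R :=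
  sup [set Num.sqrt (modulus (innerA A (B x) x) ^+ 2
                     + modulus (innerA A (C x) x) ^+ 2) | x in sphereA A].

End Operators.

(* Main.v *)
(* Write [|b|^2 + |c|^2 <= |b -/+ c|^2 + 2 |b| |c|] for [b = <Bx, x>_A] and
   [c = <Cx, x>_A]. The product [b c] is [<Cx, x>_A <x, B# x>_A], which a
   generalized Buzano inequality bounds by
   [(max(1, |1 - alpha|) ||Cx||_A ||B# x||_A + |<BCx, x>_A|) / |alpha|], and
   AM-GM gives [2 ||Cx||_A ||B# x||_A <= <(C# C + B B#) x, x>_A].
   For the real [sup]s to be genuine, operators having an [A]-adjoint must be
   [A]-bounded (Krein); for [sharp] to be the Moore-Penrose solution and not
   the default value of [xget], one needs the projection onto the closure of
   the range of [A], and the Riesz theorem for the adjoint. *)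

Require Import Defs.
From HB Require Import structures.
From mathcomp Require Import all_boot all_order all_algebra.
From mathcomp Require Import sesquilinear complex.
From mathcomp Require Import all_classical all_reals all_analysis.
From mathcomp Require Import ring lra.

Set Implicit Arguments.
Unset Strict Implicit.
Unset Printing Implicit Defensive.

Import Order.TTheory GRing.Theory Num.Theory.
Import numFieldNormedType.Exports.

Local Open Scope classical_set_scope.
Local Open Scope ring_scope.

(** * Real-valued modulus of complex numbers and a discriminant criterion *)

Section Modulus.
Variable R : realType.
Implicit Types z w : R[i].

Lemma modulusC z : (modulus z)%:C%C = `|z|.
Proof. by []. Qed.

Lemma modulus_ge0 z : 0 <= modulus z.
Proof. by case: z => a b; rewrite /modulus /= sqrtr_ge0. Qed.

Lemma modulus_sq z : modulus z ^+ 2 = complex.Re z ^+ 2 + complex.Im z ^+ 2.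
Proof.
by case: z => a b; rewrite /modulus /= sqr_sqrtr // addr_ge0 // sqr_ge0.
Qed.

Lemma modulus_eq0 z : modulus z = 0 -> z = 0.
Proof. exact: ComplexField.Normc.eq0_normc. Qed.

Lemma modulusM z w : modulus (z * w) = modulus z * modulus w.
Proof. exact: ComplexField.Normc.normcM. Qed.

Lemma modulusN z : modulus (- z) = modulus z.
Proof. by apply: complexI; rewrite !modulusC normrN. Qed.

Lemma modulusJ z : modulus z^*%C = modulus z.
Proof. by case: z => a b; rewrite /modulus /= sqrrN. Qed.

Lemma modulusD z w : modulus (z + w) <= modulus z + modulus w.
Proof. by rewrite -lecR rmorphD /= !modulusC ler_normD. Qed.

Lemma modulus_real (r : R) : modulus r%:C%C = `|r|.
Proof. by rewrite /modulus /= expr0n addr0 sqrtr_sqr. Qed.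

Lemma Re_le_modulus z : complex.Re z <= modulus z.
Proof.
apply: le_trans (ler_norm _) _.
rewrite -(ger0_norm (modulus_ge0 z)) -ler_sqr ?nnegrE ?normr_ge0 //.
by rewrite !real_normK ?num_real // modulus_sq lerDl sqr_ge0.
Qed.

(** Cross term that arises when [c = - t <x, y>_A] is put into the expansion of [||x + c y||_A^2];
    that choice of [c] makes the expansion a real quadratic in [t]. *)
Lemma Re_conjM_self (t : R) z :
  complex.Re ((- (t%:C%C * z))^*%C * z) = - t * modulus z ^+ 2.
Proof. by rewrite modulus_sq; case: z => a b /=; ring. Qed.

Lemma modulus_sqD_le z w : modulus z ^+ 2 + modulus w ^+ 2 <=
  modulus (z - w) ^+ 2 + 2 * (modulus z * modulus w).
Proof.
have := Re_le_modulus (z * w^*%C); rewrite modulusM modulusJ.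
rewrite !modulus_sq; case: z w => a b [c d] /=; lra.
Qed.

(* [t = 1 / q] minimizes the quadratic. *)
Lemma quadratic_ge0_disc (p b q : R) : 0 <= q -> 0 <= b ->
  (forall t, 0 <= p - 2 * t * b + t ^+ 2 * b * q) -> b <= p * q.
Proof.
move=> q0 b0 h; have [q_eq0|q_neq0] := eqVneq q 0; last first.
  have := h q^-1; have -> : p - 2 * q^-1 * b + q^-1 ^+ 2 * b * q = p - b / q.
    by field.
  by rewrite subr_ge0 ler_pdivrMr // lt_def q_neq0.
rewrite q_eq0 mulr0 leNgt; apply/negP => b_gt0.
(* With [q = 0] the expression is affine in [t] with slope [- 2 b < 0]; this [t] brings it down to
   [-1]. *)
have := h ((p + 1) / (2 * b)); rewrite q_eq0 mulr0 addr0.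
have -> : p - 2 * ((p + 1) / (2 * b)) * b = - 1 by field; rewrite lt0r_neq0.
by rewrite ler0N1.
Qed.

End Modulus.

(** * Geometry of the semi-inner product of a positive operator *)

Section SemiInnerProduct.
Variables (R : realType) (H : hilbertType R).
Implicit Types (A S T X : H -> H) (x y z : H) (c : R[i]).

Lemma bounded_operator_morphD T : bounded_operator T -> {morph T : x y / x + y}.
Proof. by case=> lT _ x y; have := lT 1 x y; rewrite !scale1r. Qed.

Lemma bounded_operator0 T : bounded_operator T -> T 0 = 0.
Proof.
move=> bT; have := bounded_operator_morphD bT 0 0; rewrite addr0 => h.
by apply: (@addIr _ (T 0)); rewrite add0r -h.
Qed.

Lemma bounded_operator_morphZ T c x : bounded_operator T -> T (c *: x) = c *: T x.
Proof.
move=> bT; case: (bT) => lT _; have := lT c x 0.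
by rewrite addr0 (bounded_operator0 bT) addr0.
Qed.

Lemma innerC x y : inner y x = (inner x y)^*%C.
Proof. by rewrite hermC expr0 mul1r. Qed.

Variable A : H -> H.
Hypothesis A_pos : positive_operator A.

Lemma innerADl x y z : innerA A (x + y) z = innerA A x z + innerA A y z.
Proof. by rewrite /innerA (bounded_operator_morphD A_pos.1) linearDl. Qed.

Lemma innerAZl c x z : innerA A (c *: x) z = c * innerA A x z.
Proof. by rewrite /innerA (bounded_operator_morphZ _ _ A_pos.1) linearZl_LR. Qed.

Lemma innerADr x y z : innerA A z (x + y) = innerA A z x + innerA A z y.
Proof. by rewrite /innerA linearDr. Qed.

Lemma innerAZr c x z : innerA A z (c *: x) = c^*%C * innerA A z x.
Proof. by rewrite /innerA linearZr_LR. Qed.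

(** Polarization: positivity makes the diagonal values at [x + y] and [x + i y] real, which fixes
    the imaginary and the real part of [<y, x>_A] respectively. *)
Lemma innerAC x y : innerA A y x = (innerA A x y)^*%C.
Proof.
have im0 z : complex.Im (innerA A z z) = 0 by apply: ger0_Im; exact: A_pos.2.
have := im0 (x + y); have := im0 (x + 'i%C *: y).
rewrite !(innerADl, innerADr, innerAZl, innerAZr).
have := im0 x; have := im0 y.
case: (innerA A x x) => a a' /=; case: (innerA A y y) => b b' /=.
case: (innerA A x y) => c c' /=; case: (innerA A y x) => d d' /= -> -> e f.
by apply/eqP; rewrite eq_complex /=; apply/andP; split; apply/eqP; lra.
Qed.

Lemma normA_ge0 x : 0 <= normA A x.
Proof. exact: sqrtr_ge0. Qed.

Lemma normA_sq x : normA A x ^+ 2 = complex.Re (innerA A x x).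
Proof.
rewrite /normA sqr_sqrtr //; have := A_pos.2 x.
by rewrite lecE => /andP[_].
Qed.

Lemma innerAxx x : innerA A x x = (normA A x ^+ 2)%:C%C.
Proof.
rewrite normA_sq; have := ger0_Im (A_pos.2 x); rewrite /innerA.
by case: (inner _ _) => a b /= ->.
Qed.

Lemma normAD_sq c x y : normA A (x + c *: y) ^+ 2 =
  normA A x ^+ 2 + 2 * complex.Re (c^*%C * innerA A x y)
  + modulus c ^+ 2 * normA A y ^+ 2.
Proof.
rewrite modulus_sq normA_sq !(innerADl, innerADr, innerAZl, innerAZr).
rewrite (innerAC x y) !innerAxx.
by case: (innerA A x y) => a b; case: c => u v /=; ring.
Qed.

(** Cauchy-Schwarz: [||x - t <x, y>_A y||_A^2] is a nonnegative quadratic in the real [t]. The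
    discriminant criterion also covers [||y||_A = 0], which can happen for [y] nonzero. *)
Lemma modulus_innerA x y : modulus (innerA A x y) <= normA A x * normA A y.
Proof.
rewrite -ler_sqr ?nnegrE ?modulus_ge0 ?mulr_ge0 ?normA_ge0 // exprMn.
apply: quadratic_ge0_disc; rewrite ?sqr_ge0 // => t.
have := sqr_ge0 (normA A (x + (- (t%:C%C * innerA A x y)) *: y)).
rewrite normAD_sq modulusN modulusM modulus_real exprMn real_normK ?num_real //.
by rewrite Re_conjM_self; lra.
Qed.

Lemma ler_normAD x y : normA A (x + y) <= normA A x + normA A y.
Proof.
rewrite -ler_sqr ?nnegrE ?addr_ge0 ?normA_ge0 //.
have := normAD_sq 1 x y; rewrite scale1r => ->.
rewrite rmorph1 mul1r modulus_sq /= expr0n addr0 expr1n mul1r.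
have := le_trans (Re_le_modulus _) (modulus_innerA x y).
by rewrite sqrrD; lra.
Qed.

Lemma normAZ c x : normA A (c *: x) = modulus c * normA A x.
Proof.
apply/eqP; rewrite -(eqrXn2 (n := 2)) // ?mulr_ge0 ?normA_ge0 ?modulus_ge0 //.
rewrite exprMn modulus_sq !normA_sq innerAZl innerAZr innerAxx.
by case: c => u v; apply/eqP => /=; rewrite normA_sq; ring.
Qed.

Lemma normAN x : normA A (- x) = normA A x.
Proof. by rewrite -scaleN1r normAZ modulusN /modulus ComplexField.Normc.normc1 mul1r. Qed.

(** The quadratic of Cauchy-Schwarz again, with [||x||_A^2] subtracted: its constant term is 0, so
    the criterion gives [|<x, y>_A|^2 <= 0]. *)
Lemma normA_minimal_orthogonal x y :
  (forall c, normA A x <= normA A (x + c *: y)) -> innerA A x y = 0.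
Proof.
move=> h; apply: modulus_eq0; apply/eqP; rewrite -sqrf_eq0; apply/eqP.
apply/eqP; rewrite eq_le sqr_ge0 andbT -(mul0r (normA A y ^+ 2)).
apply: quadratic_ge0_disc; rewrite ?sqr_ge0 // => t.
have := h (- (t%:C%C * innerA A x y)).
rewrite -ler_sqr ?nnegrE ?normA_ge0 // normAD_sq modulusN modulusM modulus_real.
by rewrite exprMn real_normK ?num_real // Re_conjM_self; lra.
Qed.

Lemma innerABl x y z : innerA A (x - y) z = innerA A x z - innerA A y z.
Proof. by rewrite innerADl -scaleN1r innerAZl mulN1r. Qed.

Lemma innerABr x y z : innerA A z (x - y) = innerA A z x - innerA A z y.
Proof. by rewrite innerADr -scaleN1r innerAZr rmorphN rmorph1 mulN1r. Qed.

Lemma normA_parallelogram x y :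
  normA A (x + y) ^+ 2 + normA A (x - y) ^+ 2 =
  2 * (normA A x ^+ 2 + normA A y ^+ 2).
Proof.
have := normAD_sq 1 x y; have := normAD_sq (- 1) x y.
rewrite scale1r scaleN1r => -> ->.
rewrite modulusN !modulus_sq !rmorphN !rmorph1 !mulN1r mul1r /=.
by case: (innerA A x y) => a b /=; ring.
Qed.

(* [c a b] is the [A]-inner product of [c <a, e> e] with [b]; the vector
   [c <a, e> e - a] has squared norm
   [(|1 - c|^2 - 1) |<a, e>|^2 + ||a||^2]. *)
Lemma generalized_buzano c a b e : normA A e = 1 ->
  modulus c * modulus (innerA A a e * innerA A e b) <=
  Num.max 1 (modulus (1 - c)) * (normA A a * normA A b)
  + modulus (innerA A a b).
Proof.
move=> e1; set p := innerA A a e; set u := (- a) + (c * p) *: e.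
set m := Num.max 1 (modulus (1 - c)).
have m1 : 1 <= m by rewrite le_max lexx.
have mc : modulus (1 - c) <= m by rewrite le_max lexx orbT.
have E : c * (p * innerA A e b) = innerA A a b + innerA A u b.
  by rewrite /u innerADl innerAZl -scaleN1r innerAZl; ring.
have p_le : modulus p <= normA A a.
  by rewrite (le_trans (modulus_innerA _ _)) // e1 mulr1.
have u_le : normA A u <= m * normA A a.
  rewrite -ler_sqr ?nnegrE ?mulr_ge0 ?normA_ge0 ?(le_trans ler01) //.
  have -> : normA A u ^+ 2 =
    normA A a ^+ 2 + (modulus (1 - c) ^+ 2 - 1) * modulus p ^+ 2.
    rewrite /u normAD_sq normAN e1 -scaleN1r innerAZl -/p modulusM exprMn.
    rewrite !modulus_sq; case: (p) => p1 p2; case: (c) => c1 c2 /=; ring.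
  rewrite exprMn.
  have : modulus p ^+ 2 <= normA A a ^+ 2.
    by rewrite ler_sqr ?nnegrE ?normA_ge0 ?modulus_ge0.
  have : modulus (1 - c) ^+ 2 <= m ^+ 2.
    by rewrite ler_sqr ?nnegrE ?modulus_ge0 ?(le_trans ler01).
  have : 1 <= m ^+ 2 by rewrite expr_ge1 // (le_trans ler01).
  have := sqr_ge0 (modulus p).
  move: (modulus p ^+ 2) (modulus (1 - c) ^+ 2) (m ^+ 2) (normA A a ^+ 2).
  move=> P M1 M2 N P0 M2_1 M12 PN.
  (* The sum of this product and the next is exactly [M2 N - (N + (M1 - 1) P)]. *)
  have : 0 <= (M2 - M1) * P by rewrite mulr_ge0 // subr_ge0.
  have : 0 <= (M2 - 1) * (N - P) by rewrite mulr_ge0 // subr_ge0.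
  lra.
rewrite -modulusM E (le_trans (modulusD _ _)) // [leRHS]addrC lerD2l.
rewrite (le_trans (modulus_innerA _ _)) // mulrA.
by rewrite ler_wpM2r ?normA_ge0.
Qed.

End SemiInnerProduct.

(** * The Hilbert norm as the case [A = id] *)

Section Hilbert.
Variables (R : realType) (H : hilbertType R).
Implicit Types (A S T X : H -> H) (x y z : H) (c : R[i]) (V : set H).

(** Makes the whole theory of [normA] and [innerA] available for the inner product of [H] itself,
    with real-valued norms. *)
Lemma positive_operator_id : positive_operator (id : H -> H).
Proof.
split; last by move=> x; rewrite inner_norm exprn_ge0.
by split=> //; exists 1 => x; rewrite mul1r.
Qed.
Local Notation id_pos := positive_operator_id.

Lemma innerAE x y : innerA id x y = inner x y.
Proof. by []. Qed.

Lemma innerPr c x y z : inner z (c *: x + y) = c^*%C * inner z x + inner z y.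
Proof. by rewrite -innerAE innerADr innerAZr. Qed.

Lemma norm_normA x : `|x| = (normA id x)%:C%C.
Proof.
apply/eqP; rewrite -(eqrXn2 (n := 2)) ?ler0c ?normA_ge0 //.
by rewrite -inner_norm -innerAE (innerAxx id_pos) rmorphXn.
Qed.

Lemma normA_id_eq0 x : normA id x = 0 -> x = 0.
Proof. by move=> x0; apply/normr0_eq0; rewrite norm_normA x0. Qed.

(** Trades the complex constant of the definition for a nonnegative real one, its modulus. *)
Lemma bounded_operatorP T : bounded_operator T <->
  linear T /\ exists2 K : R, 0 <= K & forall x, normA id (T x) <= K * normA id x.
Proof.
split=> -[lT]; last first.
  move=> [K _ TK]; split=> //; exists K%:C%C => x.
  by rewrite !norm_normA -rmorphM lecR.
move=> [M TM]; split=> //; exists (modulus M); rewrite ?modulus_ge0 // => x.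
rewrite -lecR rmorphM /= -!norm_normA modulusC.
rewrite -[X in _ <= _ * X]normr_id -normrM ger0_norm //.
exact: le_trans (TM x).
Qed.

Lemma closure_normAP V p : closure V p <->
  forall e : R, 0 < e -> exists2 v, V v & normA id (p - v) < e.
Proof.
split=> [Vp e e0|h B /nbhs_ballP[e /= e0]].
  have /Vp[v [Vv]] : nbhs p (ball p e%:C%C).
    by apply: nbhsx_ballx; rewrite ltcR.
  by rewrite -ball_normE /= norm_normA ltcR => ?; exists v.
have e0' : 0 < complex.Re e by move: e0; rewrite ltcE => /andP[].
have -> : e = (complex.Re e)%:C%C by rewrite RRe_real // gtr0_real.
have [v Vv pv] := h _ e0'; move=> /(_ v) Bv; exists v; split=> //.
by apply: Bv; rewrite -ball_normE /= norm_normA ltcR.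
Qed.

(** * Orthogonal projection onto the closure of a subspace *)

Definition linear_subspace V := V 0 /\ forall c x y, V x -> V y -> V (c *: x + y).

Lemma subspace_range T : bounded_operator T -> linear_subspace (range T).
Proof.
move=> bT; split; first by exists 0; rewrite ?(bounded_operator0 bT).
move=> c _ _ [x _ <-] [y _ <-]; exists (c *: x + y) => //.
by case: bT => lT _; rewrite lT.
Qed.

Lemma subspace_closure V : linear_subspace V -> linear_subspace (closure V).
Proof.
move=> [V0 VD]; split; first exact: subset_closure.
move=> c x y /closure_normAP Vx /closure_normAP Vy; apply/closure_normAP => e e0.
have c0 : 0 < modulus c + 1 by rewrite ltr_wpDl // modulus_ge0.
have [v Vv xv] := Vx (e / 2 / (modulus c + 1)) ltac:(by rewrite !divr_gt0).
have [w Vw yw] := Vy (e / 2) ltac:(by rewrite divr_gt0).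
exists (c *: v + w); first exact: VD.
have -> : c *: x + y - (c *: v + w) = c *: (x - v) + (y - w).
  by rewrite scalerBr addrACA opprD.
rewrite (le_lt_trans (ler_normAD id_pos _ _)) // (splitr e) ler_ltD //.
rewrite (normAZ id_pos); move: xv; rewrite ltr_pdivlMr // => /ltW.
apply: le_trans; rewrite mulrC ler_wpM2l ?normA_ge0 //.
by rewrite lerDl.
Qed.

Lemma normA_id_distC x y : normA id (x - y) = normA id (y - x).
Proof. by rewrite -opprB (normAN id_pos). Qed.

(** Projection theorem. By the parallelogram law a minimizing sequence in [V] is Cauchy, and its
    limit is a closest point of the closure, hence the foot of the perpendicular. *)
Lemma closure_subspace_orthogonal V x : linear_subspace V ->
  exists2 p, closure V p & forall v, V v -> inner (x - p) v = 0.
Proof.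
move=> [V0 VD].
pose D := [set normA id (x - v) | v in V].
have D_inf : has_inf D.
  split; first by exists (normA id (x - 0)), 0.
  by exists 0 => _ [v _ <-]; exact: normA_ge0.
pose d := inf D.
have d_le v : V v -> d <= normA id (x - v).
  by move=> Vv; apply: ge_inf; [exact: D_inf.2 | exists v].
have d0 : 0 <= d.
  by apply: lb_le_inf; [exact: D_inf.1|move=> _ [v _ <-]; exact: normA_ge0].
have /choice[v vP] n : exists v, V v /\ normA id (x - v) < d + n.+1%:R^-1.
  have [|_ [v Vv <-] vd] := inf_adherent (eps := n.+1%:R^-1) _ D_inf.
    by rewrite invr_gt0.
  by exists v.
(* The midpoint of [v m] and [v n] lies in [V], so the parallelogram law gives at most
   [4 (d + e)^2 - 4 d^2 = 8 d e + 4 e^2], and [e^2 <= e]. *)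
have v_dist m n e : 0 <= e -> e <= 1 -> m.+1%:R^-1 <= e -> n.+1%:R^-1 <= e ->
    normA id (v m - v n) ^+ 2 <= (8 * d + 4) * e.
  move=> e0 e1 me ne.
  have := normA_parallelogram id_pos (x - v m) (x - v n).
  have -> : x - v m - (x - v n) = v n - v m.
    by rewrite opprB addrC subrKA.
  have -> : x - v m + (x - v n) = 2 *: (x - (2^-1 *: v m + 2^-1 *: v n)).
    rewrite scalerBr scalerDr !scalerA divff ?pnatr_eq0 // !scale1r.
    by rewrite addrACA -opprD scaler_nat mulr2n.
  rewrite (normAZ id_pos) (normA_id_distC (v n)).
  have -> : modulus (2 : R[i]) = 2.
    have -> : (2 : R[i]) = (2 : R)%:C%C by rewrite rmorph_nat.
    by rewrite modulus_real ger0_norm.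
  have : d <= normA id (x - (2^-1 *: v m + 2^-1 *: v n)).
    apply: (d_le); apply: (VD); first exact: (vP m).1.
    by rewrite -[_ *: _]addr0; apply: (VD) => //; exact: (vP n).1.
  have := (vP m).2; have := (vP n).2.
  have := normA_ge0 id (x - v m); have := normA_ge0 id (x - v n).
  move: (normA id (x - v m)) (normA id (x - v n)) (normA id (x - (_ + _))).
  move: (normA id (v m - v n)) => t a b f b0 a0 bd ad df.
  have {}ad : a <= d + e by rewrite (le_trans (ltW ad)) // lerD2l.
  have {}bd : b <= d + e by rewrite (le_trans (ltW bd)) // lerD2l.
  have : a ^+ 2 <= (d + e) ^+ 2 by rewrite ler_sqr ?nnegrE ?addr_ge0.
  have : b ^+ 2 <= (d + e) ^+ 2 by rewrite ler_sqr ?nnegrE ?addr_ge0.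
  have : d ^+ 2 <= f ^+ 2 by rewrite ler_sqr ?nnegrE ?(le_trans d0).
  have : e ^+ 2 <= e by rewrite expr2 ler_piMl.
  by rewrite exprMn sqrrD; lra.
have v_cvg : cvg (v @ \oo).
  apply: cauchy_cvg; apply: cauchy_exP => e e0.
  have re0 : 0 < complex.Re e by move: e0; rewrite ltcE => /andP[].
  have -> : e = (complex.Re e)%:C%C by rewrite RRe_real // gtr0_real.
  move: (complex.Re e) re0 => {e e0} e e0.
  (* The denominator [8 d + 5] instead of [8 d + 4] makes the final inequality strict. *)
  pose f := Num.min 1 (e ^+ 2 / (8 * d + 5)).
  have f0 : 0 < f.
    by rewrite lt_min ltr01 divr_gt0 ?exprn_gt0 //; lra.
  have [N Nf] : exists N, forall n, (N <= n)%N -> n.+1%:R^-1 <= f.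
    have [N] := ltr_add_invr f0; rewrite add0r => Nf; exists N => n Nn.
    by rewrite (le_trans _ (ltW Nf)) // lef_pV2 ?posrE // ler_nat.
  exists (v N); exists N => // n /= Nn.
  rewrite -ball_normE /= norm_normA ltcR -ltr_sqr ?nnegrE ?normA_ge0 ?ltW //.
  have f1 : f <= 1 by rewrite ge_min lexx.
  apply: le_lt_trans (v_dist N n f (ltW f0) f1 (Nf N _) (Nf n Nn)) _ => //.
  have : f <= e ^+ 2 / (8 * d + 5) by rewrite ge_min lexx orbT.
  rewrite ler_pdivlMr; lra.
pose p := lim (v @ \oo).
have vp e : 0 < e -> exists2 n, normA id (p - v n) < e & normA id (x - v n) < d + e.
  move=> e0; have [N] := ltr_add_invr e0; rewrite add0r => Nf.
  move/cvgrPdist_lt : v_cvg => /(_ e%:C%C); rewrite ltcR => /(_ e0)[M _ MP].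
  exists (maxn M N); first by rewrite -ltcR -norm_normA; apply: MP; rewrite /= leq_maxl.
  rewrite (lt_le_trans (vP _).2) // lerD2l (le_trans _ (ltW Nf)) //.
  by rewrite lef_pV2 ?posrE // ler_nat ltnS leq_maxr.
exists p.
  apply/closure_normAP => e /vp[n vn _]; exists (v n) => //; exact: (vP n).1.
(* Minimality is tested at [v n - c w], which lies in [V], and carried over to [p - c w] at the cost
   of three errors below [e / 3]. *)
move=> w Vw; rewrite -innerAE; apply: (normA_minimal_orthogonal id_pos) => c.
apply/ler_addgt0Pr => e e0; have [|n pn xn] := vp (e / 3).
  by rewrite divr_gt0.
have Vvw : V (- c *: w + v n) by apply: (VD) => //; exact: (vP n).1.
have := d_le _ Vvw.
have -> : x - (- c *: w + v n) = (x - p + c *: w) + (p - v n).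
  by rewrite [RHS]addrAC subrKA scaleNr opprD opprK addrA addrAC.
have -> : x - p = (x - v n) - (p - v n) by rewrite opprB addrA subrK.
have := ler_normAD id_pos (x - v n) (- (p - v n)).
rewrite (normAN id_pos).
have := ler_normAD id_pos (x - v n - (p - v n) + c *: w) (p - v n).
move: xn pn; lra.
Qed.

(** For [v] in [V] near [p], [f p = f (p - v)] is small by boundedness. *)
Lemma closure_ker (f : H -> R[i]) (K : R) V p : 0 <= K ->
    (forall x y, f (x - y) = f x - f y) ->
    (forall x, modulus (f x) <= K * normA id x) ->
  (forall v, V v -> f v = 0) -> closure V p -> f p = 0.
Proof.
move=> K0 fB fK Vf /closure_normAP Vp.
apply: modulus_eq0; apply/eqP; rewrite eq_le modulus_ge0 andbT.
apply/ler_addgt0Pr => e e0; rewrite add0r.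
have K1 : 0 < K + 1 by rewrite ltr_wpDl.
have [|v Vv pv] := Vp (e / (K + 1)); first by rewrite divr_gt0.
have -> : f p = f (p - v) by rewrite fB (Vf v Vv) subr0.
rewrite (le_trans (fK _)) //; move: pv; rewrite ltr_pdivlMr // => /ltW.
by apply: le_trans; rewrite mulrC ler_wpM2l ?normA_ge0 // lerDl.
Qed.

Lemma orthogonal_closure V p y : (forall v, V v -> inner y v = 0) ->
  closure V p -> inner y p = 0.
Proof.
move=> Vy Vp; rewrite innerC.
have -> : inner p y = 0; last exact: conjc0.
apply: (closure_ker (f := inner^~ y) (normA_ge0 id y)) Vp => //.
- by move=> x z; exact: (innerABl id_pos).
- by move=> x; rewrite mulrC; exact: (modulus_innerA id_pos).
- by move=> v Vv; rewrite innerC (Vy v Vv) conjc0.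
Qed.

(** * Riesz representation and the adjoint *)

Lemma inner_injr x y : (forall z, inner z x = inner z y) -> x = y.
Proof.
move=> h; apply/eqP; rewrite -subr_eq0; apply/eqP/normA_id_eq0.
apply/eqP; rewrite -sqrf_eq0 (normA_sq id_pos) innerABr innerAE innerAE.
by rewrite h subrr.
Qed.

(* For [w] orthogonal to the kernel with [f w != 0], every [x] is
   [(f x / f w) *: w] modulo the kernel. *)
Lemma riesz (f : H -> R[i]) (K : R) : scalar f -> 0 <= K ->
  (forall x, modulus (f x) <= K * normA id x) -> exists z, forall x, f x = inner x z.
Proof.
move=> lf K0 fK.
have fB x y : f (x - y) = f x - f y.
  by rewrite -scaleN1r addrC lf mulN1r addrC.
have f0 : f 0 = 0 by rewrite -(subrr 0) fB subrr.
pose V := [set x | f x = 0].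
have sV : linear_subspace V.
  by split=> // c x y fx fy; rewrite /V /= lf fx fy mulr0 addr0.
have [fz|/existsNP[u fu]] := pselect (forall x, f x = 0).
  by exists 0 => x; rewrite fz linear0r.
have [p Vp ort] := closure_subspace_orthogonal u sV.
have fp : f p = 0 by apply: (closure_ker K0 fB fK _ Vp).
set w := u - p; have fw : f w != 0 by rewrite fB fp subr0; apply/eqP.
have w0 : inner w w != 0.
  apply: contra_neq fw => /eqP; rewrite -innerAE (innerAxx id_pos).
  move=> /eqP/complexI/eqP; rewrite sqrf_eq0 => /eqP/normA_id_eq0 ->.
  exact: f0.
exists (((f w / inner w w)^*%C) *: w) => x.
rewrite -innerAE innerAZr conjcK innerAE.
have : inner w (- (f x / f w) *: w + x) = 0.
  by apply: ort; rewrite /V /= lf mulNr divfK // addNr.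
move/(congr1 (@conjc R)); rewrite conjc0 -innerC -innerAE.
rewrite (innerADl id_pos) (innerAZl id_pos) innerAE innerAE mulNr => /eqP.
rewrite addrC subr_eq0 => /eqP ->; field.
by rewrite fw w0.
Qed.

(** [S y] represents the functional [x |-> <T x, y>]; linearity of [S] follows from uniqueness of
    the representing vector. *)
Lemma adjoint_ex T : bounded_operator T ->
  exists S, bounded_operator S /\ forall x y, inner (T x) y = inner x (S y).
Proof.
move=> bT; have /bounded_operatorP[lT [K K0 TK]] := bT.
have /choice[S TS] y : exists z, forall x, inner (T x) y = inner x z.
  apply: (riesz (f := fun x => inner (T x) y) (K := K * normA id y)).
  - by move=> c u v; rewrite lT linearPl.
  - by rewrite mulr_ge0 ?normA_ge0.
  - move=> x; rewrite (le_trans (modulus_innerA id_pos _ _)) // mulrAC.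
    by rewrite ler_wpM2r ?normA_ge0.
exists S; split=> // ; apply/bounded_operatorP; split.
  move=> c x y; apply: inner_injr => z.
  by rewrite -TS !innerPr !TS.
(* [||S y||^2 = <T (S y), y> <= K ||S y|| ||y||], where a nonzero [||S y||] cancels. *)
exists K => // y; have [->|Sy] := eqVneq (normA id (S y)) 0.
  by rewrite mulr_ge0 ?normA_ge0.
have Sy0 : 0 < normA id (S y) by rewrite lt_def Sy normA_ge0.
rewrite -(ler_pM2l Sy0) -expr2.
have -> : normA id (S y) ^+ 2 = modulus (inner (T (S y)) y).
  by rewrite TS -innerAE (innerAxx id_pos) modulus_real ger0_norm ?sqr_ge0.
rewrite (le_trans (modulus_innerA id_pos _ _)) //.
by rewrite mulrA [_ * K]mulrC ler_wpM2r ?normA_ge0.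
Qed.

Lemma adjointP T : bounded_operator T ->
  bounded_operator (adjoint T) /\
  forall x y, inner (T x) y = inner x (adjoint T y).
Proof. by move=> /adjoint_ex /(xgetPex 0). Qed.

End Hilbert.


(** * Comparing growth rates of powers *)

Lemma bernoulli_ineq (R : realType) (h : R) n : 0 <= h ->
  1 + n%:R * h <= (1 + h) ^+ n.
Proof.
move=> h0; elim: n => [|n IHn]; first by rewrite mul0r addr0 expr0.
rewrite exprS; apply: le_trans (ler_wpM2l (addr_ge0 ler01 h0) IHn).
have : 0 <= n%:R * h * h by rewrite !mulr_ge0.
by rewrite -natr1; lra.
Qed.

(** If [a > M], then by Bernoulli [(a / M)^(2^n)] exceeds every [L]. The exponents [2^n] are those
    produced by repeated squaring. *)
Lemma le_of_exp_bounded (R : realType) (a M L : R) : 0 < M ->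
  (forall n, a ^+ (2 ^ n) <= M ^+ (2 ^ n) * L) -> a <= M.
Proof.
move=> M0 h; rewrite leNgt; apply/negP => Ma.
pose e := a / M - 1.
have e0 : 0 < e by rewrite subr_gt0 ltr_pdivlMr // mul1r.
have [n Ln] : exists n, L < 1 + n%:R * e.
  exists (Num.bound (`|L| / e)).
  have := archi_boundP (divr_ge0 (normr_ge0 L) (ltW e0)).
  by rewrite ltr_pdivrMr //; have := ler_norm L; lra.
have := h n; rewrite mulrC -ler_pdivrMr ?exprn_gt0 // -expr_div_n.
apply/negP; rewrite -ltNge; apply: lt_le_trans Ln _.
have -> : a / M = 1 + e by rewrite addrC subrK.
apply: le_trans (bernoulli_ineq _ (ltW e0)).
by rewrite lerD2l ler_wpM2r ?ltW // ltr_nat ltn_expl.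
Qed.

(** * Formal adjoints, their [A]-boundedness, and existence of [sharp] *)

Section SharpOperator.
Variables (R : realType) (H : hilbertType R) (A : H -> H).
Hypothesis A_pos : positive_operator A.
Implicit Types (S T X : H -> H) (x y z : H) (c : R[i]).
Local Notation id_pos := (@positive_operator_id R H).

Lemma positive_operator_sym x y : inner (A x) y = inner x (A y).
Proof. by rewrite [RHS]innerC; exact: (innerAC A_pos). Qed.

Lemma bounded_operatorD S T : bounded_operator S -> bounded_operator T ->
  bounded_operator (S + T).
Proof.
move=> /bounded_operatorP[lS [K K0 SK]] /bounded_operatorP[lT [L L0 TL]].
apply/bounded_operatorP; split=> [c x y|].
  by rewrite !fctE lS lT scalerDr addrACA.
exists (K + L); first exact: addr_ge0.
by move=> x; rewrite mulrDl (le_trans (ler_normAD id_pos _ _)) // lerD.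
Qed.

Lemma bounded_operatorN T : bounded_operator T -> bounded_operator (- T).
Proof.
move=> /bounded_operatorP[lT [L L0 TL]].
apply/bounded_operatorP; split=> [c x y|].
  by rewrite !fctE lT opprD scalerN.
by exists L => // x; rewrite fctE (normAN id_pos).
Qed.

Lemma bounded_operator_comp S T : bounded_operator S -> bounded_operator T ->
  bounded_operator (S \o T).
Proof.
move=> /bounded_operatorP[lS [K K0 SK]] /bounded_operatorP[lT [L L0 TL]].
apply/bounded_operatorP; split=> [c x y|]; first by rewrite /= lT lS.
exists (K * L); first exact: mulr_ge0.
by move=> x /=; rewrite (le_trans (SK _)) // -mulrA ler_wpM2l.
Qed.

(** Adjointness for the semi-inner product. Unlike [A_adjoint] it is visibly symmetric in the two
    operators, and it passes to sums, opposites and composites, so boundedness is proved once for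
    all operators of the theorem. *)
Definition formal_adjoint T S :=
  [/\ bounded_operator T, bounded_operator S &
      forall x y, innerA A (T x) y = innerA A x (S y)].

Lemma A_adjoint_formal T S : bounded_operator T -> A_adjoint A T S ->
  formal_adjoint T S.
Proof.
move=> bT [bS AS]; split=> // x y.
have E := congr1 (@^~ y) AS; rewrite /= in E.
by rewrite /innerA !positive_operator_sym (adjointP bT).2 -E.
Qed.

Lemma formal_adjoint_sym T S : formal_adjoint T S -> formal_adjoint S T.
Proof.
by move=> [bT bS TS]; split=> // x y; rewrite innerAC // -TS -innerAC.
Qed.

Lemma formal_adjointD T1 S1 T2 S2 : formal_adjoint T1 S1 ->
  formal_adjoint T2 S2 -> formal_adjoint (T1 + T2) (S1 + S2).
Proof.
move=> [bT1 bS1 TS1] [bT2 bS2 TS2]; split; try exact: bounded_operatorD.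
by move=> x y; rewrite !fctE innerADl // innerADr TS1 TS2.
Qed.

Lemma formal_adjointN T S : formal_adjoint T S -> formal_adjoint (- T) (- S).
Proof.
move=> [bT bS TS]; split; try exact: bounded_operatorN.
move=> x y; rewrite !fctE -[- T x]scaleN1r -[- S y]scaleN1r.
by rewrite innerAZl // innerAZr TS rmorphN rmorph1.
Qed.

Lemma formal_adjoint_comp T1 S1 T2 S2 : formal_adjoint T1 S1 ->
  formal_adjoint T2 S2 -> formal_adjoint (T1 \o T2) (S2 \o S1).
Proof.
move=> [bT1 bS1 TS1] [bT2 bS2 TS2]; split; try exact: bounded_operator_comp.
by move=> x y /=; rewrite TS1 TS2.
Qed.

(** [<A x, x> <= K ||x||^2 <= (K + 1)^2 ||x||^2]; the constant [K + 1] avoids a square root of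
    [K]. *)
Lemma normA_le_norm : exists2 K : R, 0 <= K &
  forall x, normA A x <= K * normA id x.
Proof.
have /bounded_operatorP[_ [K K0 AK]] := A_pos.1.
exists (K + 1) => [|x]; first by rewrite addr_ge0.
rewrite -ler_sqr ?nnegrE ?mulr_ge0 ?normA_ge0 ?addr_ge0 // normA_sq //.
apply: le_trans (Re_le_modulus _) _.
apply: le_trans (modulus_innerA id_pos (A x) x) _.
apply: le_trans (ler_wpM2r (normA_ge0 _ _) (AK x)) _.
rewrite -mulrA -expr2 exprMn ler_wpM2r ?sqr_ge0 //.
by have := sqr_ge0 K; rewrite sqrrD; lra.
Qed.

(* Krein's iteration: for [P = S T] and [||x||_A = 1],
   [||P^k x||_A^2 <= ||P^(2k) x||_A]; taking [2^n]-th roots bounds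
   [||P x||_A] by the ordinary norm of [P]. *)
Lemma formal_adjoint_bounded T S : formal_adjoint T S ->
  exists M, forall x, sphereA A x -> normA A (T x) <= M.
Proof.
move=> fTS; have fST := formal_adjoint_sym fTS.
have [bP _ PP] := formal_adjoint_comp fST fTS.
set P := S \o T in bP PP.
have /bounded_operatorP[_ [K K0 PK]] := bP.
have K1 : 0 < K + 1 by rewrite ltr_wpDl.
have [L L0 AL] := normA_le_norm.
exists (K + 1) => x /= x1.
have iterP k u v : innerA A (iter k P u) v = innerA A u (iter k P v).
  by elim: k u => // k IHk u; rewrite iterSr IHk PP -iterS.
(* [P] is its own formal adjoint, so [||P^k x||_A^2 = <x, P^(2k) x>_A]; Cauchy-Schwarz applies with
   [||x||_A = 1]. *)
have iter_sq k : normA A (iter k P x) ^+ 2 <= normA A (iter (k + k) P x).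
  rewrite normA_sq // iterP -iterD (le_trans (Re_le_modulus _)) //.
  by rewrite (le_trans (modulus_innerA A_pos _ _)) // x1 mul1r.
have iter_norm k : normA id (iter k P x) <= (K + 1) ^+ k * normA id x.
  elim: k => [|k IHk]; first by rewrite mul1r.
  rewrite iterS (le_trans (PK _)) // exprS -mulrA.
  by rewrite ler_pM ?normA_ge0 // lerDl.
have Px : normA A (P x) <= K + 1.
  apply: (le_of_exp_bounded (L := L * normA id x)) => // n.
  rewrite mulrCA; apply: le_trans (ler_wpM2l L0 (iter_norm _)).
  apply: le_trans (AL _).
  (* Repeated squaring: [||P x||_A^(2^n) <= ||P^(2^n) x||_A]. *)
  elim: n => [|n IHn]; first by rewrite expn0 expr1.
  rewrite expnSr exprM; apply: le_trans (_ : normA A (iter (2 ^ n) P x) ^+ 2 <= _).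
    by rewrite ler_sqr ?nnegrE ?exprn_ge0 ?normA_ge0.
  by rewrite muln2 -addnn; exact: iter_sq.
(* [||T x||_A^2 = <x, P x>_A <= ||P x||_A]. *)
have : normA A (T x) ^+ 2 <= K + 1.
  rewrite normA_sq //; have [_ _ ->] := fTS.
  have -> : S (T x) = P x by [].
  rewrite (le_trans (Re_le_modulus _)) //.
  by rewrite (le_trans (modulus_innerA A_pos _ _)) // x1 mul1r.
move=> h; rewrite -ler_sqr ?nnegrE ?normA_ge0 ?(ltW K1) // (le_trans h) //.
by rewrite ler_eXnr // lerDr.
Qed.

(** The witness is [P \o S], with [P] the orthogonal projection onto the closure of the range of
    [A]. *)
Lemma sharp_ex T S : bounded_operator T -> A_adjoint A T S ->
  exists X, A_adjoint A T X /\ range X `<=` closure (range A).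
Proof.
move=> bT [bS AS].
have sV := subspace_range A_pos.1.
have [cV0 cVD] := subspace_closure sV.
have /choice[P PP] x : exists p, closure (range A) p /\
    forall v, range A v -> inner (x - p) v = 0.
  by have [p] := closure_subspace_orthogonal x sV; exists p.
have P_orth x v : closure (range A) v -> inner (x - P x) v = 0.
  by apply: orthogonal_closure; exact: (PP x).2.
have cVB x y : closure (range A) x -> closure (range A) y ->
    closure (range A) (x - y).
  by move=> Vx Vy; rewrite addrC -scaleN1r; exact: cVD.
have P_lin : linear P.
  (* The linearity defect [d] lies in the closure and is a combination of residuals [x - P x]
     orthogonal to it, so [<d, d> = 0]. *)
  move=> c x y; apply/eqP; rewrite -subr_eq0; apply/eqP.
  set d := P _ - _.
  have Vd : closure (range A) d.
    by apply: cVB; [exact: (PP _).1|apply: cVD; exact: (PP _).1].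
  have dE : d = c *: (x - P x) + (y - P y) - (c *: x + y - P (c *: x + y)).
    rewrite /d scalerBr addrACA -opprD opprB.
    by rewrite addrC [RHS]addrC subrKA.
  apply: (normA_id_eq0); apply/eqP; rewrite -sqrf_eq0 (normA_sq id_pos).
  rewrite {1}dE (innerABl id_pos) (innerADl id_pos) (innerAZl id_pos) !innerAE !P_orth //.
  by rewrite mulr0 addr0 subr0.
have P_le x : normA id (P x) <= normA id x.
  rewrite -ler_sqr ?nnegrE ?normA_ge0 //.
  have := normAD_sq id_pos 1 (x - P x) (P x).
  rewrite scale1r subrK innerAE P_orth ?mulr0; last exact: (PP x).1.
  rewrite modulus_sq /= expr1n expr0n /= ?mulr0 !addr0 mul1r => ->.
  by rewrite lerDr sqr_ge0.
(* [x - P x] is orthogonal to the range of the symmetric operator [A], hence in its kernel. *)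
have AP x : A (P x) = A x.
  apply/esym/eqP; rewrite -subr_eq0; apply/eqP.
  have -> : A x - A (P x) = A (x - P x).
    rewrite (bounded_operator_morphD A_pos.1) -[- P x]scaleN1r.
    by rewrite (bounded_operator_morphZ _ _ A_pos.1) scaleN1r.
  apply: inner_injr => z; rewrite linear0r -positive_operator_sym innerC.
  by rewrite (PP x).2 ?conjc0 //; exists z.
exists (P \o S); split; last by move=> _ [x _ <-]; exact: (PP _).1.
split; last by apply/funext => x /=; rewrite AP; exact: (congr1 (@^~ x) AS).
apply: bounded_operator_comp => //; apply/bounded_operatorP; split=> //.
by exists 1 => // x; rewrite mul1r.
Qed.

Lemma sharp_formal_adjoint T : bounded_operatorA A T ->
  formal_adjoint T (sharp A T).
Proof.
move=> [bT [S TS]]; apply: A_adjoint_formal => //.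
by have /(xgetPex 0)[] := sharp_ex bT TS.
Qed.

End SharpOperator.

(** * Genuine suprema and the bound on the product of the two forms *)

Section Radii.
Variables (R : realType) (H : hilbertType R) (A : H -> H).
Hypothesis A_pos : positive_operator A.
Implicit Types (B C S T : H -> H) (x : H).

(** The formal adjoint supplies, through Krein's bound, the upper bound without which [sup] would be
    a default value. *)
Lemma le_opnormA T S x : formal_adjoint A T S -> sphereA A x ->
  normA A (T x) <= opnormA A T.
Proof.
move=> /(formal_adjoint_bounded A_pos)[M TM] Ax.
apply: ub_le_sup; last by exists x.
by exists M => _ [y Ay <-]; exact: TM.
Qed.

Lemma modulus_innerA_sphere T x : sphereA A x ->
  modulus (innerA A (T x) x) <= normA A (T x).
Proof. by move=> /= x1; have := modulus_innerA A_pos (T x) x; rewrite x1 mulr1. Qed.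

Lemma le_numradiusA T S x : formal_adjoint A T S -> sphereA A x ->
  modulus (innerA A (T x) x) <= numradiusA A T.
Proof.
move=> /(formal_adjoint_bounded A_pos)[M TM] Ax.
apply: ub_le_sup; last by exists x.
exists M => _ [y Ay <-].
exact: le_trans (modulus_innerA_sphere T Ay) (TM y Ay).
Qed.

Lemma le_numradiusA_sq T S x : formal_adjoint A T S -> sphereA A x ->
  modulus (innerA A (T x) x) ^+ 2 <= numradiusA A T ^+ 2.
Proof.
move=> fTS Ax; have w_le := le_numradiusA fTS Ax.
have w0 : 0 <= modulus (innerA A (T x) x) by exact: modulus_ge0.
by rewrite ler_sqr ?nnegrE // (le_trans w0).
Qed.

Lemma innerA_product_bound B C alpha x : alpha != 0 ->
    bounded_operatorA A B -> bounded_operatorA A C -> sphereA A x ->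
  2 * (modulus (innerA A (B x) x) * modulus (innerA A (C x) x)) <=
  (Num.max 1 (modulus (1 - alpha))
     * opnormA A ((sharp A C \o C) + (B \o sharp A B))
   + 2 * numradiusA A (B \o C)) / modulus alpha.
Proof.
move=> alpha0 /(sharp_formal_adjoint A_pos) fB /(sharp_formal_adjoint A_pos) fC Ax.
have a0 : 0 < modulus alpha.
  rewrite lt_def modulus_ge0 andbT; apply: contra_neq alpha0.
  exact: modulus_eq0.
rewrite ler_pdivlMr // mulrC.
have [_ _ BE] := fB; have [_ _ CE] := fC.
(* Here [a = C x], [b = B# x] and [e = x], so that [<a, b>_A = <B C x, x>_A]. *)
have := generalized_buzano A_pos alpha (C x) (sharp A B x) Ax.
rewrite -!BE modulusM.
have := le_numradiusA (formal_adjoint_comp fB fC) Ax.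
(* [C# C + B B#] is its own formal adjoint, so its seminorm bounds its quadratic form, which is
   [||C x||_A^2 + ||B# x||_A^2]. *)
have fD : formal_adjoint A ((sharp A C \o C) + (B \o sharp A B))
                           ((sharp A C \o C) + (B \o sharp A B)).
  apply: (formal_adjointD A_pos).
    exact: (formal_adjoint_comp (formal_adjoint_sym A_pos fC) fC).
  exact: (formal_adjoint_comp fB (formal_adjoint_sym A_pos fB)).
have := le_opnormA fD Ax.
move/(le_trans (modulus_innerA_sphere _ Ax))/(le_trans (Re_le_modulus _)).
rewrite fctE (innerADl A_pos) /= BE.
rewrite (innerAC A_pos x (sharp A C (C x))) -CE !(innerAxx A_pos) conjc_real /=.
have : 2 * (normA A (C x) * normA A (sharp A B x)) <=
    normA A (C x) ^+ 2 + normA A (sharp A B x) ^+ 2.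
  by rewrite -subr_ge0 (_ : _ - _ = (normA A (C x) - normA A (sharp A B x)) ^+ 2)
    ?sqr_ge0 //; ring.
move=> amgm CB_le BC_le buzano; move: (le_trans amgm CB_le) => {amgm CB_le} CB_le.
have m0 : 0 <= Num.max 1 (modulus (1 - alpha)) by rewrite le_max ler01.
have := ler_wpM2l m0 CB_le; move: BC_le buzano.
rewrite -[innerA A (B (C x)) x]/(innerA A ((B \o C) x) x).
lra.
Qed.

End Radii.

Theorem theorem2p17 (R : realType) (H : hilbertType R) (A B C : H -> H)
    (A_pos : positive_operator A) (A_neq0 : A <> 0)
    (B_bA : bounded_operatorA A B) (C_bA : bounded_operatorA A C)
    (alpha : R[i]) (alpha_neq0 : alpha != 0) :
  euclradiusA A B C ^+ 2 <=
    Num.min (numradiusA A (B - C) ^+ 2) (numradiusA A (B + C) ^+ 2)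
    + (Num.max 1 (modulus (1 - alpha))
         * opnormA A ((sharp A C \o C) + (B \o sharp A B))
       + 2 * numradiusA A (B \o C)) / modulus alpha.
Proof.
have [x0|/nonemptyPn sph0] := pselect (sphereA A !=set0); last first.
  (* On an empty sphere every [sup] is 0 by convention, and both sides vanish. *)
  rewrite /euclradiusA /numradiusA /opnormA sph0 !image_set0 !sup0.
  by rewrite !mulr0 addr0 mul0r addr0 expr0n /= le_min lexx.
have fB := sharp_formal_adjoint A_pos B_bA.
have fC := sharp_formal_adjoint A_pos C_bA.
set D := (X in _ <= _ + X); set m := Num.min _ _.
have bound x : sphereA A x -> modulus (innerA A (B x) x) ^+ 2
    + modulus (innerA A (C x) x) ^+ 2 <= m + D.
  move=> Ax; have := innerA_product_bound A_pos alpha_neq0 B_bA C_bA Ax.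
  rewrite -/D => BC_D; rewrite -lerBlDr le_min; apply/andP; split.
    have := le_numradiusA_sq A_pos
      (formal_adjointD A_pos fB (formal_adjointN A_pos fC)) Ax.
    rewrite fctE (innerABl A_pos) => w_le.
    have := modulus_sqD_le (innerA A (B x) x) (innerA A (C x) x).
    move: w_le BC_D; lra.
  have := le_numradiusA_sq A_pos (formal_adjointD A_pos fB fC) Ax.
  rewrite fctE (innerADl A_pos) => w_le.
  (* The sign change turns [|b - c|] into [|b + c|] and leaves the product of moduli as it is. *)
  have := modulus_sqD_le (innerA A (B x) x) (- innerA A (C x) x).
  rewrite opprK modulusN.
  move: w_le BC_D; lra.
have [x Ax] := x0.
have mD0 : 0 <= m + D.
  by apply: le_trans (bound x Ax); rewrite addr_ge0 ?sqr_ge0.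
have E_le y : sphereA A y -> Num.sqrt (modulus (innerA A (B y) y) ^+ 2
    + modulus (innerA A (C y) y) ^+ 2) <= Num.sqrt (m + D).
  by move=> Ay; rewrite ler_sqrt // bound.
(* Comparing squares requires both sides nonnegative; a point of the sphere shows it for the
   supremum, whose set [E_le] bounds above. *)
have E_ge0 : 0 <= euclradiusA A B C.
  apply: le_trans (sqrtr_ge0 _) (ub_le_sup _ _); last by exists x.
  by exists (Num.sqrt (m + D)) => _ [y Ay <-]; exact: E_le.
rewrite -(sqr_sqrtr mD0) ler_sqr ?nnegrE ?sqrtr_ge0 //.
apply: ge_sup; first exact: image_nonempty.
by move=> _ [y Ay <-]; exact: E_le.
Qed.
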